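(* Let $n\ge 1$. The number of fixed points of $f:S_n\to S_n$ (permutations $\pi\in S_n$ with $f(\pi)=\pi$) is equal to the number of partitions of $n$.
   Context: $S_n$ is the set of permutations of $1,2,\ldots,n$, written as words $\pi=\pi_1,\ldots,\pi_n$. A Young diagram of a partition $\lambda=(\lambda_1\ge\cdots\ge\lambda_k>0)$ of $n$ is drawn in French notation: left-justified rows, with $\lambda_i$ boxes in the $i$-th row from the bottom. A standard Young tableau (SYT) of shape $\lambda$ is a filling of the boxes with $1,\ldots,n$, each used once, with rows increasing left to right and columns increasing bottom to top. RSK: for $\pi\in S_n$, $\mathrm{RSK}(\pi)=(S,T)$, where $S$ (the insertion tableau) is obtained by starting from the empty tableau and inserting $\pi_1,\pi_2,\ldots,\pi_n$ in order. To insert $a$ into a row (starting with the bottom row): if $a$ is larger than every entry of the row, place $a$ at the end of the row and stop; otherwise $a$ replaces the leftmost entry $b$ of the row that is greater than $a$, and $b$ is then inserted into the next row up by the same rule. The recording tableau $T$ has the same shape as $S$, with the box that is newly created when inserting $\pi_i$ labeled $i$. RSK is a bijection from $S_n$ to pairs of SYT of size $n$ of the same shape. The reading word of an SYT is the permutation obtained by concatenating its rows from the top row to the bottom row, each read left to right. The map $f:S_n\to S_n$ is defined by: if $\mathrm{RSK}(\pi)=(S,T)$, then $f(\pi)$ is the reading word of $T$. *)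

(* Defs.v *)
From HB Require Import structures.
From mathcomp Require Import all_boot all_fingroup.

Set Implicit Arguments.
Unset Strict Implicit.
Unset Printing Implicit Defensive.

(* The one-line notation of p, with letters 1, ..., n: 'I_n starts at 0. *)
Definition word (n : nat) (p : 'S_n) : seq nat :=
  [seq (p i).+1 | i <- enum 'I_n].

(* A tableau is the list of its rows, bottom row (the longest) first. *)
Definition tableau := seq (seq nat).

(* Returns the new row and the entry bumped out of it, if any. *)
Fixpoint insert_row (a : nat) (r : seq nat) : seq nat * option nat :=
  match r with
  | [::] => ([:: a], None)
  | b :: r' =>
    if a < b then (a :: r', Some b)
    else let: (r1, o) := insert_row a r' in (b :: r1, o)
  end.

(* Returns the new tableau and the index of the row that has gained a box. *)
Fixpoint insert (a : nat) (t : tableau) : tableau * nat :=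
  match t with
  | [::] => ([:: [:: a]], 0)
  | r :: t' =>
    match insert_row a r with
    | (r1, None) => (r1 :: t', 0)
    | (r1, Some b) => let: (t1, k) := insert b t' in (r1 :: t1, k.+1)
    end
  end.

Definition add_box (t : tableau) (k i : nat) : tableau :=
  set_nth [::] t k (rcons (nth [::] t k) i).

Definition RSK_step (ST : tableau * tableau) (ai : nat * nat) :
    tableau * tableau :=
  let: (S1, k) := insert ai.1 ST.1 in (S1, add_box ST.2 k ai.2).

Definition RSK (w : seq nat) : tableau * tableau :=
  foldl RSK_step ([::], [::]) (zip w (iota 1 (size w))).

Definition reading_word (t : tableau) : seq nat := flatten (rev t).

(* By wordF below, the default value 1 is never used. *)
Definition f (n : nat) (p : 'S_n) : 'S_n :=
  odflt 1%g [pick q : 'S_n | word q == reading_word (RSK (word p)).2].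

Lemma size_word n (p : 'S_n) : size (word p) = n.
Proof. by rewrite size_map size_enum_ord. Qed.

Lemma word_inj n : injective (@word n).
Proof.
move=> p q /eq_in_map epq; apply/permP => i.
by have [/val_inj] := epq i (mem_enum _ i).
Qed.

Lemma word_surj n (w : seq nat) :
  perm_eq w (iota 1 n) -> exists p : 'S_n, word p = w.
Proof.
move=> pw; have sw : size w = n by rewrite (perm_size pw) size_iota.
have w_in (i : 'I_n) : 0 < nth 0 w i <= n.
  have : nth 0 w i \in w by rewrite mem_nth ?sw.
  by rewrite (perm_mem pw) mem_iota add1n ltnS.
have ltw (i : 'I_n) : (nth 0 w i).-1 < n.
  by case/andP: (w_in i) => h1 h2; rewrite prednK.
have inj : injective (fun i => Ordinal (ltw i)).
  move=> i j [e]; apply/val_inj/eqP.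
  rewrite -(@nth_uniq _ 0 w) ?sw ?(perm_uniq pw) ?iota_uniq //=; apply/eqP.
  by case/andP: (w_in i) => + _; case/andP: (w_in j) => + _;
     case: nth e => // ?; case: nth => // ? /= ->.
exists (perm inj); apply: (@eq_from_nth _ 0); first by rewrite size_word.
move=> i; rewrite size_word => ltin.
rewrite (nth_map (Ordinal ltin)) ?size_enum_ord // permE /=.
rewrite nth_enum_ord // prednK //.
by case/andP: (w_in (Ordinal ltin)).
Qed.

Lemma perm_add_box t k i :
  perm_eq (flatten (add_box t k i)) (i :: flatten t).
Proof.
rewrite /add_box; elim: t k => [|r t IHt] [|k] //=.
- by elim: k => //= k IHk.
- by rewrite -cats1 -catA perm_catC /= perm_cons perm_catC.
- apply: (perm_trans (perm_cat (perm_refl r) (IHt k))).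
  by rewrite perm_catC /= perm_cons perm_catC.
Qed.

Lemma perm_RSK w : perm_eq (flatten (RSK w).2) (iota 1 (size w)).
Proof.
rewrite /RSK; move: (iota 1 _) (size_iota 1 (size w)) => s.
rewrite -[X in perm_eq _ X]/(flatten [::] ++ s).
move: [::] {1}[::] => T S; elim: w S T s => [|a w IHw] S T [|i s] //=.
  by rewrite cats0.
case=> ss; rewrite /RSK_step /=; case: (insert a S) => S1 k.
apply: (perm_trans (IHw _ _ _ ss)).
apply: (@perm_trans _ ((i :: flatten T) ++ s)).
  by rewrite perm_cat2r perm_add_box.
by rewrite perm_sym -cat_rcons perm_cat2r perm_rcons.
Qed.

Lemma wordF n (p : 'S_n) : word (f p) = reading_word (RSK (word p)).2.
Proof.
rewrite /f; case: pickP => [q /eqP //|no].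
have pw : perm_eq (reading_word (RSK (word p)).2) (iota 1 n).
  rewrite -{2}(size_word p); apply: perm_trans (perm_RSK _).
  by apply: perm_flatten; rewrite perm_rev.
by have [q /eqP] := word_surj pw; rewrite no.
Qed.

Definition is_intpart (n : nat) (l : seq nat) : bool :=
  [&& sorted geq l, 0 \notin l & sumn l == n].

Record intpart (n : nat) : predArgType :=
  IntPart { parts :> seq nat; partsP : is_intpart n parts }.

HB.instance Definition _ n := [isSub for @parts n].
HB.instance Definition _ n := [Countable of intpart n by <:].

Definition intpart_enum (n : nat) : seq (intpart n) :=
  undup (pmap insub [seq map val (bseqval l) | l : n.-bseq 'I_n.+1]).

Lemma intpart_enumP n : Finite.axiom (intpart_enum n).
Proof.
apply: Finite.uniq_enumP; first exact: undup_uniq.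
move=> l; rewrite mem_undup mem_pmap_sub inE.
case: l => l /= ln; case/and3P: (ln) => _ l0 /eqP sl.
have sz : size l <= n.
  rewrite -sl; elim: l l0 {ln sl} => //= a l IHl.
  rewrite inE negb_or eq_sym -lt0n => /andP[a0 /IHl].
  by rewrite -add1n; apply: leq_add.
have le : all (fun a => a < n.+1) l.
  apply/allP => a /(nthP 0)[i li <-]; rewrite ltnS -sl.
  by rewrite sumnE (big_nth 0) big_mkord (bigD1 (Ordinal li)) //= leq_addr.
have szl : size (map (@inord n) l) <= n by rewrite size_map.
apply/mapP; exists (Bseq szl); first by rewrite mem_enum.
rewrite /= -map_comp -[LHS]map_id; apply/eq_in_map => a /(allP le) la /=.
by rewrite inordK.
Qed.

HB.instance Definition _ n := isFinite.Build (intpart n) (@intpart_enumP n).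

(* Main.v *)
Require Import Defs.
From mathcomp Require Import all_boot all_fingroup.

(** Inserting the reading word of a semistandard tableau row by row, the j-th
    letter of a new row bumps the whole j-th column up by one. Hence the
    recording tableau of such a reading word depends only on the shape of the
    tableau. As every recording tableau is semistandard, each shape carries
    exactly one fixed point of f: the reading word of the recording tableau
    common to all reading words of that shape. *)

(** * Semistandard tableaux *)

Fixpoint row_dominated (r s : seq nat) : bool :=
  match r, s with
  | _, [::] => true
  | [::], _ :: _ => false
  | a :: r', b :: s' => (a < b) && row_dominated r' s'
  end.

(** Rows need only increase weakly: insertion handles equal letters as well, and
    [semistandard_of_shape] can then use constant rows. Excluding empty rows keeps zero parts out of
    the shape. *)
Fixpoint semistandard (t : tableau) : bool :=
  if t is r :: t' then
    [&& r != [::], sorted leq r, row_dominated r (head [::] t')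
      & semistandard t']
  else true.

Lemma row_dominated_nil r : row_dominated r [::].
Proof. by case: r. Qed.

Lemma row_dominated_size r s : row_dominated r s -> size s <= size r.
Proof. by elim: r s => [|a r IHr] [|b s] //= /andP[_ /IHr]. Qed.

Lemma row_dominated_nth r s j :
  row_dominated r s -> j < size s -> nth 0 r j < nth 0 s j.
Proof.
elim: r s j => [|a r IHr] [|b s] [|j] //= /andP[ab rs] //.
exact: IHr.
Qed.

Lemma row_dominated_rconsl r s i :
  row_dominated r s -> row_dominated (rcons r i) s.
Proof.
elim: r s => [|a r IHr] [|b s] //=.
by case/andP=> -> /IHr.
Qed.

Lemma row_dominated_rconsr r s i :
  row_dominated r s -> size s < size r -> {in r, forall x, x < i} ->
  row_dominated r (rcons s i).
Proof.
elim: r s => [|a r IHr] [|b s] //=.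
  by move=> _ _ ri; rewrite row_dominated_nil andbT ri // mem_head.
case/andP=> -> rs sz ri /=; apply: IHr => // x xr.
by apply: ri; rewrite inE xr orbT.
Qed.

(** * Insertion preserves semistandardness *)

Lemma insert_row_bumped a r r1 b : insert_row a r = (r1, Some b) -> a < b.
Proof.
elim: r r1 => [|c r IHr] r1 //=.
case: ltnP => [ac [_ <-] //|_].
by case: insert_row IHr => r2 o IHr [_ eo]; apply: (IHr r2); rewrite eo.
Qed.

Lemma insert_row_neq0 a r : (insert_row a r).1 != [::].
Proof. by case: r => [|b r] //=; case: ltnP => // _; case: insert_row. Qed.

Lemma insert_row_sorted a r : sorted leq r -> sorted leq (insert_row a r).1.
Proof.
have path_ins c s : path leq c s -> c <= a -> path leq c (insert_row a s).1.
  elim: s c => [|d s IHs] c /=; first by move=> _ ->.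
  case/andP=> cd ds ca; case: ltnP => [ad|da] /=.
    by rewrite ca /=; apply: (path_le leq_trans (ltnW ad)).
  by have := IHs _ ds da; case: insert_row => s1 o /= ->; rewrite cd.
case: r => //= c r cr; case: ltnP => [ac|ca] /=.
  exact: (path_le leq_trans (ltnW ac)).
by have := path_ins _ _ cr ca; case: insert_row.
Qed.

Lemma insert_row_dominated a r s :
  row_dominated r s -> row_dominated (insert_row a r).1 s.
Proof.
elim: r s => [|c r IHr] [|d s] //=.
  by move=> _; exact: row_dominated_nil.
case/andP=> cd rs; case: ltnP => [ac|ca] /=.
  by rewrite (ltn_trans ac cd).
by have := IHr _ rs; case: insert_row => r1 o /= ->; rewrite cd.
Qed.

(** The entry of [s] above the bumped [b], if any, exceeds [b], so [b] lands weakly left of the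
    column it came from. Up to that column every entry of [r1] is at most [a], hence below [b]. *)
Lemma insert_row_dominated_bumped a r r1 s b :
  row_dominated r s -> insert_row a r = (r1, Some b) ->
  row_dominated r1 (insert_row b s).1.
Proof.
elim: r r1 s => [|c r IHr] r1 s //=.
case: ltnP => [ac|ca].
  case: s => [_ [<- <-]|d s] /=; first by rewrite ac row_dominated_nil.
  by case/andP=> cd rs [<- <-]; rewrite cd /= ac.
case er: (insert_row a r) => [r2 o] rs [<- eo]; subst o.
have cb := leq_ltn_trans ca (insert_row_bumped _ _ _ _ er).
case: s rs => [_|d s] /=; first by rewrite cb row_dominated_nil.
case/andP=> cd rs; case: ltnP => [bd|db] /=.
  by have := insert_row_dominated a _ _ rs; rewrite er cb.
by have := IHr _ _ rs er; case: insert_row => s1 o /= ->; rewrite cd.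
Qed.

Lemma insert_row_None_size a r r1 :
  insert_row a r = (r1, None) -> size r1 = (size r).+1.
Proof.
elim: r r1 => [|c r IHr] r1 /=; first by case=> <-.
case: ltnP => // _; case: insert_row IHr => r2 o IHr [<- eo] /=.
by rewrite (IHr r2) ?eo.
Qed.

Lemma insert_row_Some_size a r r1 b :
  insert_row a r = (r1, Some b) -> size r1 = size r.
Proof.
elim: r r1 => [|c r IHr] r1 //=.
case: ltnP => [_ [<- _] //|_]; case: insert_row IHr => r2 o IHr [<- eo] /=.
by rewrite (IHr r2) ?eo.
Qed.

Lemma head_insert a t :
  head [::] (insert a t).1 = (insert_row a (head [::] t)).1.
Proof.
case: t => //= r t; case: insert_row => r1 [b|] //=.
by case: insert.
Qed.

Lemma insert_semistandard a t : semistandard t -> semistandard (insert a t).1.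
Proof.
elim: t a => //= r t IHt a /and4P[r0 sr rt st].
case er: (insert_row a r) => [r1 [b|]].
  have hd := head_insert b t; have {IHt} := IHt b st.
  case: insert hd => t1 k /= hd ->.
  have := insert_row_neq0 a r; have := insert_row_sorted a r sr.
  rewrite er hd /= => -> -> /=; rewrite andbT.
  exact: insert_row_dominated_bumped er.
have := insert_row_neq0 a r; have := insert_row_sorted a r sr.
by have := insert_row_dominated a r _ rt; rewrite er /= st => -> -> ->.
Qed.

Lemma shape_insert a t :
  shape (insert a t).1 = incr_nth (shape t) (insert a t).2.
Proof.
elim: t a => //= r t IHt a.
case er: (insert_row a r) => [r1 [b|]] /=.
  have := IHt b; case: insert => t1 k /= ->.
  by rewrite (insert_row_Some_size _ _ _ _ er).
by rewrite (insert_row_None_size _ _ _ er).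
Qed.

Lemma shape_add_box t k i : shape (add_box t k i) = incr_nth (shape t) k.
Proof.
elim: t k => [|r t IHt] [|k] //=.
- by congr (_ :: _); elim: k => //= k ->.
- by rewrite size_rcons.
- by rewrite -IHt.
Qed.

Lemma semistandard_shape t :
  semistandard t -> sorted geq (shape t) /\ 0 \notin shape t.
Proof.
elim: t => //= r t IHt /and4P[r0 _ rt /IHt[st t0]].
rewrite inE negb_or t0 eq_sym size_eq0 r0 andbT; split=> //.
by case: t rt st {IHt t0} => //= s t /row_dominated_size -> ->.
Qed.

(** Since [i] exceeds all entries, only the position of the new box matters: weakly decreasing row
    lengths put a box under it, and the absence of zero parts rules out the empty rows with which
    [set_nth] pads. *)
Lemma add_box_semistandard t k i :
  semistandard t -> {in flatten t, forall x, x < i} ->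
  sorted geq (shape (add_box t k i)) -> 0 \notin shape (add_box t k i) ->
  semistandard (add_box t k i).
Proof.
rewrite !shape_add_box; elim: t k => [|r t IHt] [|k] //=.
  move=> /and4P[r0 sr rt st] ti _ _; rewrite /add_box /= st andbT.
  rewrite row_dominated_rconsl // andbT -size_eq0 size_rcons /=.
  case: r ti sr {r0 rt} => //= a r ti ar; rewrite rcons_path ar /=.
  by apply/ltnW/ti; rewrite -cat_cons mem_cat mem_last.
move=> /and4P[r0 sr rt st] ti srt; rewrite inE negb_or => /andP[_ t0].
change (semistandard (r :: add_box t k i)).
rewrite /= r0 sr /= IHt ?(path_sorted srt) //.
- rewrite andbT; case: k srt {t0} => [|k].
    have -> : head [::] (add_box t 0 i) = rcons (head [::] t) i.
      by case: t {IHt rt st ti}.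
    move=> srt; apply: row_dominated_rconsr => //.
      by case: t srt {IHt rt st ti} => [|s t] /= /andP[].
    by move=> x xr; apply: ti; rewrite mem_cat xr.
  by case: t rt {IHt st ti} => //= *; rewrite row_dominated_nil.
- by move=> x xt; apply: ti; rewrite mem_cat xt orbT.
Qed.

(** * The two tableaux of RSK *)

Lemma RSK_rcons w a :
  RSK (rcons w a) = RSK_step (RSK w) (a, (size w).+1).
Proof.
rewrite /RSK size_rcons -(addn1 (size w)) iotaD cats1 zip_rcons ?size_iota //.
by rewrite foldl_rcons addnC.
Qed.

Lemma RSK1_rcons w a : (RSK (rcons w a)).1 = (insert a (RSK w).1).1.
Proof. by rewrite RSK_rcons /RSK_step /=; case: insert. Qed.

Lemma RSK2_rcons w a :
  (RSK (rcons w a)).2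
    = add_box (RSK w).2 (insert a (RSK w).1).2 (size w).+1.
Proof. by rewrite RSK_rcons /RSK_step /=; case: insert. Qed.

(** Both shapes grow by the same box. The insertion tableau stays semistandard, so the common shape
    is a partition, as [add_box_semistandard] requires of the recording tableau. *)
Lemma RSK_semistandard w :
  [/\ semistandard (RSK w).1, semistandard (RSK w).2
    & shape (RSK w).1 = shape (RSK w).2].
Proof.
elim/last_ind: w => [|w a [s1 s2 sh]] //.
rewrite RSK1_rcons RSK2_rcons.
have s1' := insert_semistandard a _ s1.
have sh' : shape (insert a (RSK w).1).1
    = shape (add_box (RSK w).2 (insert a (RSK w).1).2 (size w).+1).
  by rewrite shape_insert shape_add_box sh.
split=> //; have [] := semistandard_shape _ s1'; rewrite sh'.
apply: add_box_semistandard => // x.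
by rewrite (perm_mem (perm_RSK w)) mem_iota => /andP[].
Qed.

(** * Inserting a reading word *)

(* The tableau obtained from [t] by inserting the first [j] letters of a row
   [r] that [t]'s bottom row dominates: the first [j] columns move up by one. *)
Fixpoint shift_up (j : nat) (r : seq nat) (t : tableau) : tableau :=
  match t with
  | [::] => if j is 0 then [::] else [:: take j r]
  | s :: t' => (take j r ++ drop j s) :: shift_up j s t'
  end.

Lemma shift_up0 r t : shift_up 0 r t = t.
Proof. by elim: t r => //= s t IHt r; rewrite take0 drop0 IHt. Qed.

Lemma shift_up_oversize j r t :
  semistandard (r :: t) -> size r <= j -> shift_up j r t = r :: t.
Proof.
elim: t r => [|s t IHt] r.
  case: j => [|j] /= /and4P[r0 _ _ _] rj; first by case: r r0 rj.
  by rewrite take_oversize.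
case/and4P=> _ _ /row_dominated_size sr st rj /=.
have sj := leq_trans sr rj.
by rewrite take_oversize // drop_oversize // cats0 IHt.
Qed.

Lemma insert_row_cat a r s :
  all (fun x => x <= a) r ->
  insert_row a (r ++ s) = (r ++ (insert_row a s).1, (insert_row a s).2).
Proof.
elim: r => [|c r IHr] /=; first by case: insert_row.
by case/andP=> ca /IHr ->; rewrite ltnNge ca.
Qed.

(** The inserted letter is at least everything in [take j r] and smaller than the entry above it in
    [t], so it bumps exactly that entry, which meets the next row in the same situation. The new box
    tops column [j], so its row depends on the shape alone. *)
Lemma insert_shift_up j r t :
  semistandard (r :: t) -> j < size r ->
  insert (nth 0 r j) (shift_up j r t)
    = (shift_up j.+1 r t, count (fun m => j < m) (shape t)).
Proof.
elim: t r => [|s t IHt] r ssr jr; have /and4P[r0 sr rt st] := ssr.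
all: have le_r : all (fun x => x <= nth 0 r j) (take j r).
1,3: apply/(all_nthP 0) => i; rewrite size_takel ?(ltnW jr) // => ij;
     rewrite nth_take //; apply: (sorted_leq_nth leq_trans leqnn) => //;
     rewrite ?inE ?(ltn_trans ij jr) //; exact: ltnW.
  case: j jr le_r => [|j] jr le_r /=.
    by case: r jr {r0 sr rt st ssr le_r} => //= x r _; rewrite take0.
  rewrite -[take _ _ in LHS]cats0 insert_row_cat //=.
  by rewrite cats1 -take_nth.
rewrite /= insert_row_cat //.
have [js|sj] := ltnP j (size s); last first.
  (* Column [j] of [t] is empty: the letter ends the bottom row, and the count is 0 because row
     lengths decrease weakly. *)
  rewrite drop_oversize //= drop_oversize ?(leqW sj) // cats0 cats1 -take_nth //.
  rewrite !shift_up_oversize ?(leqW sj) // add0n.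
  congr (_, _); apply/esym/eqP; rewrite -leqn0 leqNgt -has_count.
  apply/hasPn => m mt; rewrite -leqNgt (leq_trans _ sj) //.
  have geq_trans : transitive geq.
    by move=> x y z /= xy zx; apply: leq_trans zx xy.
  have [/(order_path_min geq_trans)/allP le _] := semistandard_shape (s :: t) st.
  exact: le.
rewrite (drop_nth 0 js) /= row_dominated_nth //=.
by rewrite IHt //= (take_nth 0 jr) cat_rcons.
Qed.

(** The upper rows are read first and rebuilt by induction. The bottom rows then enter in parallel,
    and [insert_shift_up] puts each new box in the same row for both words. *)
Lemma RSK_reading_word t t' :
  semistandard t -> semistandard t' -> shape t = shape t' ->
  [/\ (RSK (reading_word t)).1 = t, (RSK (reading_word t')).1 = t'
    & (RSK (reading_word t)).2 = (RSK (reading_word t')).2].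
Proof.
elim: t t' => [|r t IHt] [|r' t'] // sst sst' [er et].
have reading_cons (x : seq nat) y : reading_word (x :: y) = reading_word y ++ x.
  by rewrite /reading_word rev_cons flatten_rcons.
have /and4P[_ _ _ st] := sst; have /and4P[_ _ _ st'] := sst'.
have [e1 e1' e2] := IHt _ st st' et.
have size_reading : size (reading_word t) = size (reading_word t').
  by rewrite !size_flatten !/shape !map_rev -/(shape t) -/(shape t') et.
have step j : j <= size r ->
  [/\ (RSK (reading_word t ++ take j r)).1 = shift_up j r t,
      (RSK (reading_word t' ++ take j r')).1 = shift_up j r' t'
    & (RSK (reading_word t ++ take j r)).2
        = (RSK (reading_word t' ++ take j r')).2].
  elim: j => [|j IHj] jr; first by rewrite !take0 !cats0 !shift_up0.
  have [h1 h1' h2] := IHj (ltnW jr); have jr' := jr; rewrite er in jr'.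
  rewrite (take_nth 0 jr) (take_nth 0 jr') -!rcons_cat.
  rewrite !RSK1_rcons !RSK2_rcons h1 h1' h2 !insert_shift_up //= et.
  by rewrite !size_cat size_reading !size_takel // ltnW.
have [] := step _ (leqnn _).
rewrite !shift_up_oversize ?er // -{1 3}er !take_size -!reading_cons.
by split.
Qed.

(** Fill each row with copies of its index: columns increase strictly because no row is longer than
    the one below. *)
Lemma semistandard_of_shape l :
  sorted geq l -> 0 \notin l -> exists2 t, semistandard t & shape t = l.
Proof.
pose fill := fix fill i l :=
  if l is m :: l' then nseq m i :: fill i.+1 l' else [::].
move=> sl l0; exists (fill 0 l); last first.
  by elim: l {sl l0} 0 => //= m l IHl i; rewrite size_nseq IHl.
elim: l sl l0 0 => //= m l IHl sl; rewrite inE negb_or => /andP[m0 l0] i.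
rewrite IHl ?(path_sorted sl) // andbT -size_eq0 size_nseq eq_sym m0 /=.
apply/andP; split.
  by case: {sl m0} m => //= m; elim: m => //= m ->; rewrite leqnn.
case: l sl {IHl l0} => [|k l] /=; first by rewrite row_dominated_nil.
case/andP=> + _; elim: k {m0} m => [|k IHk] [|m] //= km.
by rewrite ltnSn IHk.
Qed.

(** * Fixed points and partitions *)

Lemma is_intpart_shape_RSK n (p : 'S_n) :
  is_intpart n (shape (RSK (word p)).2).
Proof.
have [_ s2 _] := RSK_semistandard (word p).
have [srt n0] := semistandard_shape _ s2.
rewrite /is_intpart srt n0 -size_flatten (perm_size (perm_RSK _)).
by rewrite size_iota size_word eqxx.
Qed.

Theorem corollary3p9 (n : nat) (n_ge1 : 1 <= n) :
  #|[set p : 'S_n | f p == p]| = #|{: intpart n}|.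
Proof.
pose sh (p : 'S_n) := IntPart (is_intpart_shape_RSK n p).
(* Injectivity: a fixed point is the reading word of its recording tableau, which is therefore
   determined by its shape. *)
rewrite -(@card_in_imset _ _ sh); last first.
  move=> p q; rewrite !inE => /eqP fp /eqP fq [eq_sh].
  have [_ sp _] := RSK_semistandard (word p).
  have [_ sq _] := RSK_semistandard (word q).
  apply: word_inj; have [_ _] := RSK_reading_word _ _ sp sq eq_sh.
  by rewrite -!wordF fp fq => eqT; rewrite -fp -fq !wordF eqT.
rewrite -cardsT; congr #|pred_of_set _|.
apply/setP => l; rewrite inE; apply/imsetP.
have /and3P[srt l0 /eqP suml] := partsP l.
have [t st tl] := semistandard_of_shape _ srt l0.
have [_ sq eq_sh] := RSK_semistandard (reading_word t).
have [e1 _ _] := RSK_reading_word _ _ st st erefl.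
rewrite e1 in eq_sh.
(* The word of [t] may repeat letters, but its recording tableau is standard and of the same shape.
   By [eqT] the reading word of that tableau has the same recording tableau, so it is fixed by
   [f]. *)
have [_ _ eqT] := RSK_reading_word _ _ st sq eq_sh.
have [p wp] : exists p : 'S_n, word p = reading_word (RSK (reading_word t)).2.
  apply: word_surj; apply: perm_trans (perm_trans (perm_RSK (reading_word t)) _).
    by apply: perm_flatten; rewrite perm_rev.
  rewrite size_flatten /shape map_rev sumn_rev -/(shape t) tl suml.
  exact: perm_refl.
exists p; first by rewrite inE; apply/eqP/word_inj; rewrite wordF wp -eqT.
by apply: val_inj; rewrite /= wp -eqT -eq_sh tl.
Qed.
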